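(* Let $n\ge 2$, $k\in\{1,\dots,n-1\}$ and $H=\mathrm{lin}\{\mathrm{e}_1,\dots,\mathrm{e}_k\}\subset\mathbb{R}^n$. Let $K\subset\mathbb{R}^n$ be a non-empty convex bounded set. Then \[ \mathrm{G}_{n-k}(P_{H^\perp} K)\,\mathrm{G}_{k}(K\cap H)\leq\binom{n}{k}\,\mathrm{G}_{n}\bigl(K+(-1,1)^n\bigr). \]
   Context: $\mathrm{e}_i$ is the $i$-th canonical unit vector of $\mathbb{R}^n$, $\mathrm{lin}$ denotes linear hull, $H^\perp$ is the orthogonal complement of $H$, and $P_{H^\perp}$ is the orthogonal projection onto $H^\perp$. For $M\subset\mathbb{R}^n$, $\mathrm{G}_n(M)=|M\cap\mathbb{Z}^n|$; for $M\subset H$, $\mathrm{G}_k(M)=|M\cap(\mathbb{Z}^k\times\{0_{n-k}\})|$; for $M\subset H^\perp$, $\mathrm{G}_{n-k}(M)=|M\cap(\{0_k\}\times\mathbb{Z}^{n-k})|$. The sum $A+B=\{a+b:a\in A,\ b\in B\}$ is the Minkowski sum. *)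

(* Defs.v *)
From mathcomp Require Import all_boot all_order all_algebra finmap.
From mathcomp Require Import all_classical all_reals all_analysis.

Set Implicit Arguments.
Unset Strict Implicit.
Unset Printing Implicit Defensive.

Import Order.TTheory GRing.Theory Num.Theory.
Import numFieldNormedType.Exports.

Local Open Scope classical_set_scope.
Local Open Scope ring_scope.

(* Points of R^n are row vectors, and linear subspaces of R^n are row spaces of
   n x n matrices.  Coordinates are numbered from 0, so e_1, ..., e_k are the
   [delta_mx 0 i] with [i < k]. *)

Definition coord_subspace (R : realType) (n k : nat) : 'M[R]_n :=
  (\sum_(i < n | (i < k)%N) <<delta_mx 0 i : 'rV[R]_n>>)%MS.

Definition subspace_set (R : realType) (n : nat) (U : 'M[R]_n) :
    set 'rV[R]_n :=
  [set x | (x <= U)%MS].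

(* [orthomx] at the identity automorphism and the identity Gram matrix, i.e. for
   the standard inner product [x *m y^T]. *)
Definition orth_compl (R : realType) (n : nat) (U : 'M[R]_n) : 'M[R]_n :=
  orthomx idfun 1%:M U.

Definition orth_proj (R : realType) (n : nat) (U : 'M[R]_n) (x : 'rV[R]_n) :
    'rV[R]_n :=
  x *m proj_mx U (orth_compl U).

Definition Minkowski_sum (R : realType) (n : nat) (A B : set 'rV[R]_n) :
    set 'rV[R]_n :=
  [set a + b | a in A & b in B].

Definition open_cube (R : realType) (n : nat) : set 'rV[R]_n :=
  [set x | forall i, -1 < x 0 i < 1].

Definition int_lattice (R : realType) (n : nat) : set 'rV[R]_n :=
  [set x | forall i, x 0 i \is a Num.int].

(* The lattices Z^k x {0_(n-k)} and {0_k} x Z^(n-k) inside R^n. *)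
Definition int_lattice_fst (R : realType) (n k : nat) : set 'rV[R]_n :=
  [set x | int_lattice x /\ forall i : 'I_n, (k <= i)%N -> x 0 i = 0].

Definition int_lattice_snd (R : realType) (n k : nat) : set 'rV[R]_n :=
  [set x | int_lattice x /\ forall i : 'I_n, (i < k)%N -> x 0 i = 0].

(* [fset_set] is [fset0] on infinite sets, so these are the true cardinalities
   as long as only finitely many lattice points are involved, in particular for
   bounded [M]. *)
Definition lattice_count (R : realType) (n : nat) (M : set 'rV[R]_n) : nat :=
  #|` fset_set (M `&` @int_lattice R n)|.

Definition lattice_count_fst (R : realType) (n k : nat) (M : set 'rV[R]_n) :
    nat :=
  #|` fset_set (M `&` @int_lattice_fst R n k)|.

Definition lattice_count_snd (R : realType) (n k : nat) (M : set 'rV[R]_n) :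
    nat :=
  #|` fset_set (M `&` @int_lattice_snd R n k)|.

(* Main.v *)
(* Rounding down sends the points of K + [0,1)^n to lattice points of
   K + (-1,1)^n, so K + [0,1)^n contains at most N^n G_n(K + (-1,1)^n) points of
   (1/N)Z^n.  Let A and B be the sets of lattice points of the projection and of
   the section of K, with a and b elements.  The set
   (j/N)(A + [0,1)^(n-k)) contains exactly a j^(n-k) points of the refined
   lattice, and by convexity the fibre of K + [0,1)^n over each of them contains
   a translate of (1 - j/N)(B + [0,1)^k), hence at least b (N-j)^k of its points.
   Using for every point of the projection the smallest possible j, and bounding
   powers below by falling factorials, a Vandermonde-type identity yields
   a b k! (n-k)! C(N,n) <= N^n G_n(K + (-1,1)^n); let N tend to infinity. *)

Require Import Defs.
From mathcomp Require Import all_boot all_order all_algebra finmap.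
From mathcomp Require Import all_classical all_reals all_analysis.
From mathcomp Require Import zify ring lra.

Set Implicit Arguments.
Unset Strict Implicit.
Unset Printing Implicit Defensive.

Import Order.TTheory GRing.Theory Num.Theory.
Import numFieldNormedType.Exports.

Local Open Scope classical_set_scope.
Local Open Scope ring_scope.

(** * Integer points of dilated unions of half-open cubes *)

(** The integer points of m (F + [0,1)^n). The refined lattice (1/N)Z^n is scaled by N, so that all
    counting is done with integer vectors. *)
Definition dilation (n m : nat) (F : {fset 'rV[int]_n}) : {fset 'rV[int]_n} :=
  [fset (fsval p.1 *+ m + map_mx (fun i : 'I_m => (i : nat)%:Z) p.2)%R
     | p in {: F * 'rV['I_m]_n}]%fset.

Lemma dilationP (n m : nat) (F : {fset 'rV[int]_n}) (V : 'rV[int]_n) :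
  reflect (exists2 g, g \in F &
             exists r : 'rV['I_m]_n, forall i, V 0 i = g 0 i *+ m + (r 0 i : nat)%:Z)
          (V \in dilation m F).
Proof.
apply: (iffP (imfsetP _ _ _ _)) => [[[g r] _ /= ->]|[g gF [r eV]]].
  by exists (fsval g); [exact: fsvalP|exists r => i; rewrite !mxE mulmxnE].
exists ([` gF]%fset, r) => //=.
by apply/rowP => i; rewrite eV !mxE mulmxnE.
Qed.

Lemma mem_dilation (n m : nat) (F : {fset 'rV[int]_n}) (V : 'rV[int]_n) :
  (0 < m)%N -> map_mx (fun v => (v %/ m)%Z) V \in F -> V \in dilation m F.
Proof.
move=> m_gt0 FV; apply/dilationP; exists (map_mx (fun v => (v %/ m)%Z) V) => //.
have lt_mod (v : int) : (`|(v %% m)%Z| < m)%N by lia.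
exists (\row_i Ordinal (lt_mod (V 0 i))) => i; rewrite !mxE /=; lia.
Qed.

(** Division with remainder by m recovers g and r from g m + r, so the parametrisation is
    injective. *)
Lemma card_dilation (n m : nat) (F : {fset 'rV[int]_n}) :
  #|` dilation m F| = (#|` F| * m ^ n)%N.
Proof.
rewrite card_in_imfset /= => [|[g r] [h s] _ _ /= /rowP eqV].
  by rewrite -cardT card_prod card_mx card_ord mul1n -cardfE.
have quo (a : int) (x : 'I_m) : ((a *+ m + (x : nat)%:Z) %/ m)%Z = a.
  have m_gt0 : (0 < m)%N by case: (m) x => // -[].
  rewrite -mulr_natr natz divzMDl ?divz_small ?addr0 //; last lia.
  by have := ltn_ord x; lia.
have eqVi i : (val g 0 i = val h 0 i) * (r 0 i = s 0 i).
  have := eqV i; rewrite !mxE !mulmxnE => eqVi.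
  have eq1 : val g 0 i = val h 0 i.
    by have := congr1 (fun v => (v %/ m)%Z) eqVi; rewrite /= !quo.
  by split=> //; apply: val_inj; move: eqVi; rewrite eq1 => /addrI[].
congr pair; last by apply/rowP => i; rewrite (eqVi i).2.
by apply: val_inj; apply/rowP => i; rewrite (eqVi i).1.
Qed.

(** * Binomial sums and falling factorials *)

(** Sorts the subsets of {0, ..., N-1} with d + e + 1 elements by the element m that has d smaller
    and e larger ones. The proof is by Pascal's rule. *)
Lemma sum_bin_mul (d e N : nat) :
  (\sum_(m < N) 'C(m, d) * 'C(N.-1 - m, e) = 'C(N, d + e.+1))%N.
Proof.
elim: N e => [|N IHN] e; first by rewrite big_ord0 addnS bin0n.
rewrite big_ord_recr /= subnn.
have shift (m : 'I_N) : (N - m = (N.-1 - m).+1)%N by have := ltn_ord m; lia.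
under eq_bigr do rewrite shift.
case: e => [|e].
  under eq_bigr => m _ do rewrite bin0 -(bin0 (N.-1 - m)).
  by rewrite IHN addn1 muln1 binS.
under eq_bigr do rewrite binS mulnDr.
by rewrite big_split /= !IHN muln0 addn0 !addnS binS.
Qed.

(** Only the m from j on contribute; after a shift by j this is [sum_bin_mul] with d = 0. *)
Lemma sum_bin_tail (k j N : nat) (P : pred nat) :
  (j <= N)%N -> (forall m, P m -> (j <= m)%N) ->
  (\sum_(m < N) P m * 'C(N.-1 - m, k) <= 'C(N - j, k.+1))%N.
Proof.
move=> /subnKC <- Pj; rewrite addKn; move: (N - j)%N => M.
rewrite big_split_ord /= big1 ?add0n => [|m _]; last first.
  by case: (boolP (P m)) => // /Pj; have := ltn_ord m; lia.
rewrite -[k.+1]add0n -sum_bin_mul; apply: leq_sum => m _.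
rewrite bin0 leq_mul ?leq_b1 //.
by rewrite (_ : _ - _ = M.-1 - m)%N //; have := ltn_ord m; lia.
Qed.

Lemma ffact_leq_exp (m d : nat) : (m ^_ d <= m ^ d)%N.
Proof. by elim: d => // d IHd; rewrite ffactnSr expnSr leq_mul ?leq_subr. Qed.

Lemma fact_bin_leq_exp (m d : nat) : (d`! * 'C(m, d) <= m ^ d)%N.
Proof. by rewrite mulnC bin_ffact ffact_leq_exp. Qed.

(** Replacing a power by a falling factorial costs only a term of lower order in m; the constant is
    crude. *)
Lemma exp_leq_ffact (m d : nat) : (m ^ d.+1 <= m ^_ d.+1 + d.+1 ^ 2 * m ^ d)%N.
Proof.
elim: d => [|d IHd]; first by rewrite ffactn1 expn1 leq_addr.
have := ffact_leq_exp m d.+1; move: IHd.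
rewrite (ffactnSr m d.+1) !(expnSr m) [(d.+1 ^ 2)%N]expnSr [(d.+2 ^ 2)%N]expnSr !expn1.
(* The new factor [m - d.+1] is truncated to 0 when m is small. *)
move: (m ^_ d.+1)%N (m ^ d)%N => f p; case: (leqP d.+1 m) => dm; nia.
Qed.

(** * Counting over fibres *)

Lemma card_fibers_leq (T U : choiceType) (f : T -> U) (X : {fset T}) (Y : {fset U}) :
  (\sum_(y <- Y) #|` [fset x in X | f x == y]%fset| <= #|` X|)%N.
Proof.
under eq_bigr do rewrite card_fset_sum1 big_fset /= big_mkcond /=.
rewrite exchange_big /= (card_fset_sum1 X); apply: leq_sum => x _.
rewrite -big_mkcond /= sum1_count.
rewrite (eq_count (a2 := pred1 (f x))) => [|y /=]; last by rewrite eq_sym.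
by rewrite count_uniq_mem ?fset_uniq ?leq_b1.
Qed.

(** If j is minimal for Y, the fibre over Y has at least |B| (N-j)^(k+1) points, which is bounded
    below by a sum over m from j to N-1. Exchanging the sums over Y and m leaves, for each m, the
    number of Y with minimal j at most m. *)
Lemma slices_bound (k d N : nat) (A : {fset 'rV[int]_d.+1})
    (B : {fset 'rV[int]_k.+1}) (X : {fset 'rV[int]_(k.+1 + d.+1)}) :
  (forall j Y, (j < N)%N -> Y \in dilation j A -> exists c,
     forall W, W \in dilation (N - j) B -> row_mx (c + W) Y \in X) ->
  (#|` A| * #|` B| * (k.+1`! * d.+1`! * 'C(N, k.+1 + d.+1)) <= #|` X|)%N.
Proof.
move=> slices.
(* [T m Y] means that the minimal j for Y is at most m. The sets [dilation j A] need not increase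
   with j, hence the quantifier. *)
pose T m Y := [exists j : 'I_m.+1, Y \in dilation j A].
pose U := (\bigcup_(j <- iota 0 N) dilation j A)%fset.
pose fiber Y := [fset V in X | rsubmx V == Y]%fset.
have fiber_ge Y :
    (k.+1`! * #|` B| * \sum_(m < N) T m Y * 'C(N.-1 - m, k) <= #|` fiber Y|)%N.
  have [/existsP[m0 T0]|noT] := boolP [exists m : 'I_N, T m Y]; last first.
    rewrite big1 ?muln0 // => m _; move/existsPn: noT => /(_ m) /negbTE -> //.
  have exj : exists j, Y \in dilation j A.
    by have /existsP[j Yj] := T0; exists j.
  case: (ex_minnP exj) => j Yj minj.
  have jN : (j < N)%N.
    have /existsP[i /minj] := T0.
    by have := ltn_ord i; have := ltn_ord m0; lia.
  have [c cP] := slices j Y jN Yj.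
  (* The translate supplied by [slices] embeds into the fibre over Y. *)
  apply: (@leq_trans (#|` dilation (N - j) B|)); last first.
    have inj : injective (fun W => row_mx (c + W) Y) by move=> W W' /eq_row_mx[/addrI].
    rewrite -(_ : #|` [fset row_mx (c + W)%R Y | W in dilation (N - j) B]%fset| =
                 #|` dilation (N - j) B|).
      apply: fsubset_leq_card; apply/fsubsetP => _ /imfsetP[W /= WB ->].
      by rewrite !inE cP //= row_mxKr.
    by rewrite card_imfset.
  (* Minimality of j makes [T m Y] fail for m < j. *)
  have tail : (\sum_(m < N) T m Y * 'C(N.-1 - m, k) <= 'C(N - j, k.+1))%N.
    apply: (@sum_bin_tail k j N (T^~ Y)) => [|m /existsP[i /minj]]; first exact: ltnW.
    by have := ltn_ord i; lia.
  have pow := fact_bin_leq_exp (N - j) k.+1.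
  rewrite card_dilation [(k.+1`! * _)%N]mulnC -mulnA leq_mul2l.
  by rewrite (leq_trans _ pow) ?orbT // leq_mul2l tail orbT.
apply: leq_trans _ (card_fibers_leq rsubmx X U).
apply: (@leq_trans (\sum_(Y <- U) k.+1`! * #|` B| *
                      \sum_(m < N) T m Y * 'C(N.-1 - m, k))%N); last first.
  by apply: leq_sum => Y _; apply: fiber_ge.
rewrite -big_distrr /= exchange_big /=.
under eq_bigr do rewrite -big_distrl /=.
(* Already the points of [dilation m A] satisfy [T m]. *)
have count_ge (m : 'I_N) : (#|` A| * (d.+1`! * 'C(m, d.+1)) <= \sum_(Y <- U) T m Y)%N.
  apply: (@leq_trans #|` dilation m A|).
    by rewrite card_dilation leq_mul2l fact_bin_leq_exp orbT.
  rewrite (_ : (\sum_(Y <- U) T m Y)%N = #|` [fset Y in U | T m Y]%fset|); last first.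
    rewrite card_fset_sum1 big_fset /= [RHS]big_mkcond.
    by apply: eq_bigr => Y _; case: (T m Y).
  apply: fsubset_leq_card; apply/fsubsetP => Y YA; rewrite !inE.
  apply/andP; split; last by apply/existsP; exists ord_max.
  by apply/bigfcupP; exists (m : nat) => //; rewrite mem_iota /= ltn_ord.
(* With the summands swapped, [sum_bin_mul] applies to the lower indices [d.+1] and [k]. *)
rewrite addnC -sum_bin_mul !big_distrr /=; apply: leq_sum => m _.
apply: leq_trans _ (leq_mul (leqnn _) (leq_mul (count_ge m) (leqnn _))).
apply: eq_leq; ring.
Qed.

(** * Passage to the limit in N *)

Lemma leq_of_asymptotic (a g n : nat) :
  (forall N, a * N ^_ n <= g * N ^ n)%N -> (a <= g)%N.
Proof.
case: n => [|n] asym; first by have := asym 0%N; rewrite !muln1.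
rewrite leqNgt; apply/negP => lt_ga.
(* If g < a, then [exp_leq_ffact] forces N <= (g+1)(n+1)^2; this N is one larger. *)
pose N := (g.+1 * n.+1 ^ 2).+1.
have := asym N; have := exp_leq_ffact N n; rewrite expnS.
have : (0 < N ^ n)%N by rewrite expn_gt0.
rewrite /N; nia.
Qed.

(** * Orthogonal projection along a coordinate subspace *)

Lemma sub_orth_compl (R : realType) (m n : nat) (W : 'M[R]_(m, n)) (U : 'M[R]_n) :
  (W <= orth_compl U)%MS = (W *m U^T == 0).
Proof. by rewrite (sameP sub_kermxP eqP) mul1mx map_mx_id. Qed.

Lemma row_mulmx_tr_eq0 (R : realDomainType) (n : nat) (v : 'rV[R]_n) :
  v *m v^T = 0 -> v = 0.
Proof.
move/matrixP/(_ 0 0); rewrite !mxE => sum0; apply/rowP => i; rewrite mxE.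
have sq0 : forall j, true -> 0 <= v 0 j * v^T j 0.
  by move=> j _; rewrite mxE -expr2 sqr_ge0.
have := psumr_eq0P sq0 sum0 (erefl true : xpredT i); rewrite mxE => /eqP.
by rewrite -expr2 sqrf_eq0 => /eqP.
Qed.

(** Trivial intersection is what makes [proj_mx] fix the first subspace and kill the second. A
    common vector v = w U has v v^T = v U^T w^T = 0. *)
Lemma capmx_orth_compl (R : realType) (n : nat) (U : 'M[R]_n) :
  (U :&: orth_compl U = 0)%MS.
Proof.
apply/eqP/rowV0P => v; rewrite sub_capmx sub_orth_compl => /andP[/submxP[w vE] /eqP vU0].
by apply: row_mulmx_tr_eq0; rewrite {2}vE trmx_mul mulmxA vU0 mul0mx.
Qed.

Lemma orth_complK_sub (R : realType) (n : nat) (U : 'M[R]_n) :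
  (U <= orth_compl (orth_compl U))%MS.
Proof.
rewrite sub_orth_compl -trmx_eq0 trmx_mul trmxK -sub_orth_compl.
exact: submx_refl.
Qed.

Lemma sub_coord_subspace (R : realType) (k d : nat) (u : 'rV[R]_k) :
  (row_mx u 0 <= coord_subspace R (k + d) k)%MS.
Proof.
rewrite (row_sum_delta (row_mx u 0)); apply: summx_sub => i _.
case: (split_ordP i) => j ->; last by rewrite row_mxEr mxE scale0r sub0mx.
rewrite scalemx_sub //; apply: (sumsmx_sup (lshift d j)); first exact: (ltn_ord j).
by rewrite genmxE.
Qed.

(** The first block lies in H, hence in the double complement, and is killed; the second is
    orthogonal to H and is fixed. *)
Lemma orth_proj_split (R : realType) (k d : nat) (x : 'rV[R]_(k + d)) :
  orth_proj (orth_compl (coord_subspace R (k + d) k)) x = row_mx 0 (rsubmx x).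
Proof.
set H := coord_subspace R (k + d) k; rewrite /orth_proj.
have -> : x = row_mx (lsubmx x) 0 + row_mx 0 (rsubmx x).
  by rewrite add_row_mx addr0 add0r hsubmxK.
rewrite mulmxDl proj_mx_0 ?capmx_orth_compl //; last first.
  exact: submx_trans (sub_coord_subspace _ _) (orth_complK_sub _).
rewrite add0r proj_mx_id ?capmx_orth_compl //.
  by rewrite add_row_mx addr0 add0r row_mxKr.
rewrite sub_orth_compl -trmx_eq0 trmx_mul trmxK -sub_kermx.
apply/sumsmx_subP => i ik; rewrite genmxE sub_kermx; apply/eqP.
rewrite -rowE; apply/rowP => l; rewrite mxE ord1 mxE.
case: (split_ordP i) ik => j -> //= _.
by rewrite row_mxEl !mxE.
Qed.

(** * Convexity, integer points and boundedness *)

Lemma convex_setP (R : realType) (n : nat) (K : set 'rV[R]_n) (x y : 'rV[R]_n) (t : R) :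
  convex_set (M := 'rV[R]_n) K -> K x -> K y -> 0 <= t <= 1 ->
  K (t *: x + (1 - t) *: y).
Proof.
move=> Kconv Kx Ky /andP[t0 t1].
have := Kconv x y (Itv01 t0 t1); rewrite !inE => /(_ Kx Ky).
exact.
Qed.

Lemma int_latticeP (R : realType) (n : nat) (x : 'rV[R]_n) :
  int_lattice x -> map_mx intr (map_mx Num.floor x) = x.
Proof. by move=> xZ; apply/rowP => i; rewrite !mxE floorK ?xZ. Qed.

Lemma int_lattice_map (R : realType) (n : nat) (z : 'rV[int]_n) :
  int_lattice (map_mx intr z : 'rV[R]_n).
Proof. by move=> i; rewrite mxE intr_int. Qed.

Lemma finite_lattice_bounded (R : realType) (n : nat) (A : set 'rV[R]_n) (M : R) :
  (forall x i, A x -> `|x 0 i| <= M) -> finite_set (A `&` @int_lattice R n).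
Proof.
move=> Abound; pose m := `|Num.ceil M|%N.
(* Integer entries in [-m, m], shifted by m, range over a finite type. *)
pose f (r : 'rV['I_(m + m).+1]_n) : 'rV[R]_n := \row_i ((r 0 i : nat)%:Z - m%:Z)%:~R.
apply: (@sub_finite_set _ _ (f @` setT)); last exact/finite_image/finite_finset.
move=> x [Ax /int_latticeP xE]; pose z := map_mx Num.floor x.
have zb i : (`|(z 0 i + m%:Z)%R| < (m + m).+1)%N /\ 0 <= z 0 i + m%:Z.
  have := Abound x i Ax; rewrite -xE -/z mxE -intr_norm => zM.
  have : `|z 0 i| <= Num.ceil M.
    by rewrite -(ler_int R) (le_trans zM) ?ceil_ge.
  rewrite /m; lia.
exists (\row_i Ordinal (zb i).1) => //; apply/rowP => i.
by rewrite -[in RHS]xE -/z !mxE /= gez0_abs ?(zb i).2 // addrK [RHS]mxE.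
Qed.

Lemma norm_row_entry (R : realType) (n : nat) (x : 'rV[R]_n) (i : 'I_n) :
  `|x 0 i| <= `|x|.
Proof.
have -> : `|x| = mx_norm x by [].
by rewrite mx_normrE; exact: (le_bigmax _ (fun ij => `|x ij.1 ij.2|) (0, i)).
Qed.

Lemma finite_lattice_Minkowski (R : realType) (n : nat) (K : set 'rV[R]_n) :
  bounded_set K -> finite_set (Minkowski_sum K (@open_cube R n) `&` @int_lattice R n).
Proof.
move=> /pinfty_ex_gt0[M _ KM]; apply: (@finite_lattice_bounded _ _ _ (M + 1)).
move=> _ i [x Kx [u /(_ i) ucube <-]]; rewrite mxE (le_trans (ler_normD _ _)) // lerD //.
  exact: le_trans (norm_row_entry x i) (KM x Kx).
by rewrite ler_norml; move: ucube => /andP[/ltW -> /ltW ->].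
Qed.

(** * Slices of the Minkowski sum *)

(** Both V/N - p and V/N - z, where z is V/N rounded down, lie in [0,1)^n, so their difference z - p
    lies in (-1,1)^n. *)
Lemma floor_div_Minkowski (R : realType) (n N : nat) (K : set 'rV[R]_n)
    (p : 'rV[R]_n) (V : 'rV[int]_n) :
  (0 < N)%N -> K p -> (forall i, 0 <= (V 0 i)%:~R - N%:R * p 0 i < N%:R) ->
  Minkowski_sum K (@open_cube R n) (map_mx intr (map_mx (fun v => (v %/ N)%Z) V)).
Proof.
move=> N_gt0 Kp Vp; set z := map_mx intr _; exists p => //.
exists (z - p); last by rewrite addrC subrK.
move=> i; rewrite !mxE; have := Vp i; set q := divz (V 0 i) N%:Z.
have [q_le q_gt] : 0 <= V 0 i - q * N%:Z /\ V 0 i - q * N%:Z < N%:Z by rewrite /q; lia.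
have NR : 0 < N%:R :> R by rewrite ltr0n.
move: q_le q_gt; rewrite -(ler_int R) -(ltr_int R) rmorphB rmorphM /= -pmulrn => q_le q_gt.
move=> /andP[p_le p_gt]; rewrite -(ltr_pM2l NR) -[X in _ && X](ltr_pM2l NR).
by apply/andP; split; lra.
Qed.

(** The point p = (j/N) x + (1 - j/N)(b, 0) of K serves for [floor_div_Minkowski]: in the last d
    coordinates the difference to N p is r < j. *)
Lemma slice_shift (R : realType) (k d j N : nat) (K : set 'rV[R]_(k + d))
    (x : 'rV[R]_(k + d)) (a Y : 'rV[int]_d) (r : 'rV['I_j]_d) :
  convex_set (M := 'rV[R]_(k + d)) K -> K x -> rsubmx x = map_mx intr a -> (j < N)%N ->
  (forall i, Y 0 i = a 0 i *+ j + (r 0 i : nat)%:Z) ->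
  exists c : 'rV[int]_k, forall (b W : 'rV[int]_k) (s : 'rV['I_(N - j)]_k),
    K (row_mx (map_mx intr b) 0) ->
    (forall i, W 0 i = b 0 i *+ (N - j) + (s 0 i : nat)%:Z) ->
    Minkowski_sum K (@open_cube R (k + d))
      (map_mx intr (map_mx (fun v => (v %/ N)%Z) (row_mx (c + W) Y))).
Proof.
(* Rounding j x up adds less than 1 to s <= N - j - 1, so the first k coordinates exceed those of N
   p by less than N - j. The shift is the same for all b and W. *)
move=> Kconv Kx xa jN YE; exists (map_mx (fun t => Num.ceil (j%:R * t)) (lsubmx x)).
move=> b W s Kb WE.
have N_gt0 : (0 < N)%N by exact: leq_ltn_trans jN.
have NR : 0 < N%:R :> R by rewrite ltr0n.
have t01 : 0 <= (j%:R / N%:R : R) <= 1.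
  apply/andP; split; first by apply: divr_ge0; rewrite ler0n.
  by rewrite ler_pdivrMr // mul1r ler_nat ltnW.
have := convex_setP Kconv Kx Kb t01; set p := _ + _ => Kp.
apply: (floor_div_Minkowski N_gt0 Kp) => i.
have pE : N%:R * p 0 i = j%:R * x 0 i + (N - j)%:R * row_mx (map_mx intr b) 0 0 i.
  rewrite !mxE natrB 1?ltnW //; field; rewrite gt_eqF //.
rewrite pE; case: (split_ordP i) => l ->.
  rewrite !row_mxEl !mxE WE; move: (j%:R * _) => y.
  have /andP[] := ceil_itv y; move: (Num.ceil y) => c; rewrite rmorphB /= => yc cy.
  have sNj : (s 0 l)%:R + 1 <= (N - j)%:R :> R by rewrite natr1 ler_nat ltn_ord.
  have NjN : (N - j)%:R <= N%:R :> R by rewrite ler_nat leq_subr.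
  rewrite !rmorphD rmorphMn /= -mulr_natl -[(Posz _)%:~R]pmulrn.
  have s0 : 0 <= (s 0 l)%:R :> R by rewrite ler0n.
  by apply/andP; split; lra.
have xl : x 0 (rshift k l) = (a 0 l)%:~R by move/rowP/(_ l): xa; rewrite !mxE.
rewrite !row_mxEr YE xl !mxE mulr0 addr0 rmorphD rmorphMn /= -mulr_natl -[(Posz _)%:~R]pmulrn.
rewrite [_ + (r 0 l)%:R]addrC addrK ler0n ltr_nat.
exact: ltn_trans (ltn_ord _) jN.
Qed.

(** * Lattice counts as cardinalities of sets of integer vectors *)

Lemma fset_set_sub_set (T : choiceType) (L : set T) (v : T) : v \in fset_set L -> L v.
Proof.
have [Lfin|Linf] := pselect (finite_set L); first by rewrite in_fset_set // inE.
(* On an infinite set [fset_set] is empty, so nothing is to be shown. *)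
by rewrite /fset_set; case: pselect => // _; rewrite inE.
Qed.

(** A lattice point of the projection is determined by its last d entries, and these are the last
    entries of some point of K. *)
Lemma lattice_count_snd_lift (R : realType) (k d : nat) (K : set 'rV[R]_(k + d)) :
  exists2 A : {fset 'rV[int]_d},
    #|` A| = lattice_count_snd k
      (orth_proj (orth_compl (coord_subspace R (k + d) k)) @` K) &
    forall a, a \in A -> exists2 x, K x & rsubmx x = map_mx intr a.
Proof.
rewrite /lattice_count_snd; set L := _ `&` _.
have LP v : L v -> v = row_mx 0 (map_mx intr (map_mx Num.floor (rsubmx v))).
  move=> [[x _ <-] [vZ _]]; rewrite !map_rsubmx int_latticeP //.
  by rewrite orth_proj_split row_mxKr.
exists [fset map_mx Num.floor (rsubmx v) | v in fset_set L]%fset.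
  apply: card_in_imfset => v w /fset_set_sub_set/LP vE /fset_set_sub_set/LP wE eqvw.
  by rewrite vE wE eqvw.
move=> _ /imfsetP[v /fset_set_sub_set Lv ->]; have [[x Kx xv] _] := Lv.
exists x => //; move: (LP v Lv); rewrite -{1}xv orth_proj_split.
by move=> /eq_row_mx[].
Qed.

Lemma lattice_count_fst_coords (R : realType) (k d : nat) (K : set 'rV[R]_(k + d))
    (H : set 'rV[R]_(k + d)) :
  exists2 B : {fset 'rV[int]_k},
    #|` B| = lattice_count_fst k (K `&` H) &
    forall b, b \in B -> K (row_mx (map_mx intr b) 0).
Proof.
rewrite /lattice_count_fst; set L := _ `&` _.
have LP v : L v -> v = row_mx (map_mx intr (map_mx Num.floor (lsubmx v))) 0.
  move=> [_ [vZ v0]]; rewrite !map_lsubmx int_latticeP //.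
  rewrite -[LHS]hsubmxK; congr row_mx.
  by apply/rowP => i; rewrite !mxE v0 //= leq_addr.
exists [fset map_mx Num.floor (lsubmx v) | v in fset_set L]%fset.
  apply: card_in_imfset => v w /fset_set_sub_set/LP vE /fset_set_sub_set/LP wE eqvw.
  by rewrite vE wE eqvw.
move=> _ /imfsetP[v /fset_set_sub_set Lv ->].
by rewrite -(LP v Lv); case: Lv => -[].
Qed.

(** Here every lattice point must be caught by [fset_set], so boundedness of K enters through
    finiteness. *)
Lemma lattice_count_Minkowski_cover (R : realType) (n : nat) (K : set 'rV[R]_n) :
  bounded_set K ->
  exists2 G : {fset 'rV[int]_n},
    (#|` G| <= lattice_count (Minkowski_sum K (@open_cube R n)))%N &
    forall z, Minkowski_sum K (@open_cube R n) (map_mx intr z) -> z \in G.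
Proof.
move=> /finite_lattice_Minkowski; rewrite /lattice_count; set L := _ `&` _ => Lfin.
exists [fset map_mx Num.floor v | v in fset_set L]%fset; first exact: leq_imfset_card.
move=> z Kz; apply/imfsetP; exists (map_mx intr z).
  by rewrite /= in_fset_set // inE; split=> //; exact: int_lattice_map.
by apply/rowP => i; rewrite !mxE intrKfloor.
Qed.

(** * The inequality between the lattice counts *)

Theorem theorem1p3 (R : realType) (n k : nat) (K : set 'rV[R]_n)
    (n_ge2 : (2 <= n)%N) (k_range : (1 <= k <= n - 1)%N)
    (K_neq0 : K !=set0)
    (K_convex : convex_set (M := 'rV[R]_n) K)
    (K_bounded : bounded_set K) :
  let H := coord_subspace R n k in
  (lattice_count_snd k (orth_proj (orth_compl H) @` K) *
   lattice_count_fst k (K `&` subspace_set H) <=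
   'C(n, k) * lattice_count (Minkowski_sum K (@open_cube R n)))%N.
Proof.
case: k k_range => // k k_range; have [d nE] : exists d, n = (k.+1 + d.+1)%N.
  by exists (n - k.+2)%N; lia.
move: K K_neq0 K_convex K_bounded; rewrite {}nE => K _ K_convex K_bounded; cbv zeta.
have [A <- liftA] := lattice_count_snd_lift K.
have [B <- memB] := lattice_count_fst_coords K (subspace_set (coord_subspace R _ k.+1)).
have [G cardG memG] := lattice_count_Minkowski_cover K_bounded.
apply: leq_trans (leq_mul (leqnn _) cardG).
apply: (@leq_of_asymptotic _ _ (k.+1 + d.+1)) => N.
have slices j Y : (j < N)%N -> Y \in dilation j A -> exists c,
    forall W, W \in dilation (N - j) B -> row_mx (c + W) Y \in dilation N G.
  move=> jN /dilationP[a /liftA[x Kx xa] [r YE]].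
  have [c cP] := slice_shift K_convex Kx xa jN YE; exists c => W.
  move=> /dilationP[b /memB Kb [s WE]]; apply: mem_dilation; first exact: leq_ltn_trans jN.
  exact/memG/(cP b W s).
have := slices_bound slices; rewrite card_dilation.
(* The falling factorial of N is C(N,n) n!, and n! = C(n,k) k! (n-k)!; this is where the factor
   C(n,k) arises. *)
rewrite -bin_ffact -(bin_fact (leq_addr d.+1 k.+1)) addKn.
move=> /(leq_mul (leqnn 'C(k.+1 + d.+1, k.+1))).
by congr (_ <= _)%N; ring.
Qed.
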